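(* Let $q$ be a prime power, let $1\le k\le m$ be integers, and let $\mathcal{C}\subseteq\mathrm{Mat}(k\times m,\mathbb{F}_q)$ be a non-zero $\mathbb{F}_q$-linear code of dimension $1\le t\le km$. Then: (1) $a_1(\mathcal{C})=\mathrm{minrk}(\mathcal{C})$; (2) $a_t(\mathcal{C})\le k$; (3) for any $1\le r\le t-1$, $a_r(\mathcal{C})\le a_{r+1}(\mathcal{C})$; (4) for any $1\le r\le t-m$, $a_r(\mathcal{C})<a_{r+m}(\mathcal{C})$; (5) for any $1\le r\le t$, $a_r(\mathcal{C})\le k-\lfloor (t-r)/m\rfloor$; (6) for any $1\le r\le t$, $a_r(\mathcal{C})\ge \lceil r/m\rceil$.
   Context: For a Delsarte code (an $\mathbb{F}_q$-subspace) $\mathcal{C}\subseteq\mathrm{Mat}(k\times m,\mathbb{F}_q)$: $\mathrm{minrk}(\mathcal{C}):=\min\{\mathrm{rk}(M):M\in\mathcal{C},\ \mathrm{rk}(M)>0\}$ and $\mathrm{maxrk}(\mathcal{C}):=\max\{\mathrm{rk}(M):M\in\mathcal{C}\}$. One always has $\dim_{\mathbb{F}_q}(\mathcal{C})\le m\cdot\mathrm{maxrk}(\mathcal{C})$; $\mathcal{A}^D_q(k,m)$ is the set of Delsarte codes attaining equality (Delsarte optimal anticodes). For $1\le r\le \dim_{\mathbb{F}_q}(\mathcal{C})$, the $r$-th Delsarte generalized weight is $a_r(\mathcal{C}):=\frac1m\min\{\dim_{\mathbb{F}_q}(\mathcal{A}):\mathcal{A}\in\mathcal{A}^D_q(k,m),\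 \dim_{\mathbb{F}_q}(\mathcal{A}\cap\mathcal{C})\ge r\}$. *)

(* Defs.v *)
From HB Require Import structures.
From mathcomp Require Import all_boot all_order all_algebra.
From mathcomp Require Import boolp.
Set Implicit Arguments. Unset Strict Implicit. Unset Printing Implicit Defensive.
Import Order.TTheory GRing.Theory Num.Theory.
Local Open Scope ring_scope.

Section Delsarte.
Variables (F : finFieldType) (k m : nat).

Definition delsarte_code := {vspace 'M[F]_(k, m)}.

(* minrk(C) := min { rk M : M in C, rk M > 0 }  (default k if empty) *)
Definition minrk (C : delsarte_code) : nat :=
  \big[minn/k]_(M : 'M[F]_(k, m) | (M \in C) && (0 < \rank M)%N) \rank M.

Definition maxrk (C : delsarte_code) : nat :=
  \max_(M : 'M[F]_(k, m) | M \in C) \rank M.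

Definition is_optimal_anticode (A : delsarte_code) : Prop :=
  \dim A = (m * maxrk A)%N.

(* min { dim A : A optimal anticode, dim (A cap C) >= r }; every such A has
   dim A <= k*m, so the minimum is over n in [0, k*m] (default k*m if empty,
   which never happens for r <= dim C since the full space qualifies). *)
Definition min_anticode_dim (C : delsarte_code) (r : nat) : nat :=
  \big[minn/(k * m)%N]_(n < (k * m).+1 |
      `[< exists A : delsarte_code,
            [/\ is_optimal_anticode A, (r <= \dim (A :&: C))%N & \dim A = n] >])
    (n : nat).

Definition delsarte_gw (C : delsarte_code) (r : nat) : rat :=
  (min_anticode_dim C r)%:R / m%:R.

End Delsarte.

(* Main.v *)
Require Import Defs.
From HB Require Import structures.
From mathcomp Require Import all_boot all_order all_algebra.
From mathcomp Require Import boolp zify.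
Set Implicit Arguments. Unset Strict Implicit. Unset Printing Implicit Defensive.
Import Order.TTheory GRing.Theory Num.Theory.
Local Open Scope ring_scope.

(** Parts (1), (2), (3), (5) and (6) only use the optimal anticodes made of the
    matrices whose column space lies in a fixed subspace. Part (4) rests on
    [optimal_anticode_chain]: an optimal anticode V of maximal rank R contains
    an optimal anticode of codimension m.

    Let P be the set of positions of the first nonzero entries (in row-major
    order) of the elements of V, so that dim V <= |P|. A matching inside P
    yields an element of V whose rank is at least the size of the matching, so
    by König's theorem P is covered by R lines. Since |P| >= mR and k <= m,
    these lines are R rows or, when k = m, R columns. Up to transposition, V is
    thus parametrised by R rows that can be chosen freely, and the rank bound
    forces every other row to be a fixed linear combination of these: V consists
    of the products U N with U of full column rank R, and one drops a column of
    U. *)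

(** * König's theorem for sets of positions in a grid *)

Section Konig.
Variables I J : finType.
Implicit Types (P Q : {set I * J}) (A : {set I}) (B : {set J}).

Definition line_cover A B P :=
  [forall p in P, (p.1 \in A) || (p.2 \in B)].

Definition coverable n P :=
  [exists A : {set I}, exists B : {set J},
     (#|A| + #|B| <= n)%N && line_cover A B P].

Lemma line_coverP A B P :
  reflect (forall p, p \in P -> (p.1 \in A) || (p.2 \in B)) (line_cover A B P).
Proof. exact: forall_inP. Qed.

Lemma coverableP n P :
  reflect (exists A B, (#|A| + #|B| <= n)%N /\ line_cover A B P)
          (coverable n P).
Proof.
apply: (iffP existsP) => [[A /existsP[B /andP[le_n cov]]]|[A [B [le_n cov]]]].
  by exists A, B.
by exists A; apply/existsP; exists B; rewrite le_n.
Qed.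

(* Uncrossing: of the covers (A1 & A2, B1 | B2) and (i + A1 | A2, B1 & B2),
   whose sizes add up to at most 2n + 1, one has size at most n. *)
Lemma coverable_uncross_row n Q e f : e != f -> e.1 = f.1 ->
  coverable n (Q :\ e) -> coverable n (Q :\ f) -> coverable n Q.
Proof.
move=> nef e1 /coverableP[A1 [B1 [s1 /line_coverP c1]]].
move=> /coverableP[A2 [B2 [s2 /line_coverP c2]]].
have [eA1|eA1] := boolP (e.1 \in A1).
  apply/coverableP; exists A1, B1; split=> //; apply/line_coverP => p pQ.
  by have [->|ne] := eqVneq p e; [rewrite eA1|apply: c1; rewrite !inE ne].
have [fA2|fA2] := boolP (f.1 \in A2).
  apply/coverableP; exists A2, B2; split=> //; apply/line_coverP => p pQ.
  by have [->|ne] := eqVneq p f; [rewrite fA2|apply: c2; rewrite !inE ne].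
have cA := cardsUI A1 A2; have cB := cardsUI B1 B2.
have cU := cardsU1 e.1 (A1 :|: A2).
apply/coverableP; have [small|big] := leqP (#|A1 :&: A2| + #|B1 :|: B2|)%N n.
  exists (A1 :&: A2), (B1 :|: B2); split=> //; apply/line_coverP => p pQ.
  rewrite !inE; have [pe|pne] := eqVneq p e.
    have /orP[] : (e.1 \in A2) || (e.2 \in B2) by apply: c2; rewrite !inE nef -pe.
      by rewrite e1 (negPf fA2).
    by rewrite pe => ->; rewrite !orbT.
  have [pf|pnf] := eqVneq p f.
    have /orP[] : (f.1 \in A1) || (f.2 \in B1).
      by apply: c1; rewrite !inE eq_sym nef -pf.
      by rewrite -e1 (negPf eA1).
    by rewrite pf => ->; rewrite !orbT.
  have := c1 p; have := c2 p; rewrite !inE pne pnf pQ => /(_ isT) h2 /(_ isT).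
  by move: h2; do 4![case: (_ \in _)].
exists (e.1 |: (A1 :|: A2)), (B1 :&: B2); split.
  by move: cU; case: (_ \notin _); lia.
apply/line_coverP => p pQ; rewrite !inE.
have [//|pe1] := eqVneq p.1 e.1.
have pne : p != e by apply: contraNneq pe1 => ->.
have pnf : p != f by apply: contraNneq pe1 => ->; rewrite e1.
have := c1 p; have := c2 p; rewrite !inE pne pnf pQ => /(_ isT) h2 /(_ isT).
by move: h2; do 4![case: (_ \in _)].
Qed.

End Konig.

Definition swap_set (I J : finType) (P : {set I * J}) : {set J * I} :=
  [set (p.2, p.1) | p in P].

Lemma mem_swap_set (I J : finType) (P : {set I * J}) p :
  (p \in swap_set P) = ((p.2, p.1) \in P).
Proof.
case: p => j i /=; apply/imsetP/idP => [[[i' j'] /= pP [-> ->]] //|pP].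
by exists (i, j).
Qed.

Lemma coverable_swap (I J : finType) n (P : {set I * J}) :
  coverable n (swap_set P) = coverable n P.
Proof.
apply/coverableP/coverableP => -[A [B [s /line_coverP c]]]; exists B, A;
  rewrite addnC; split=> //; apply/line_coverP => -[i j] /= pP; rewrite orbC.
  by apply: (c (j, i)); rewrite mem_swap_set.
by apply: (c (j, i)); rewrite mem_swap_set in pP.
Qed.

(** Transposing the grid exchanges rows and columns, which reduces this to
    [coverable_uncross_row]. *)
Lemma coverable_uncross_col (I J : finType) n (Q : {set I * J}) e f :
  e != f -> e.2 = f.2 ->
  coverable n (Q :\ e) -> coverable n (Q :\ f) -> coverable n Q.
Proof.
case: e f => [i j] [i' j'] /= nef ej ce cf; rewrite -coverable_swap.
have swapD p : swap_set Q :\ (p.2, p.1) = swap_set (Q :\ p).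
  apply/setP => -[b a]; rewrite !(inE, mem_swap_set) /=; case: p => a' b' /=.
  by congr (~~ _ && _); apply/eqP/eqP => -[-> ->].
apply: (@coverable_uncross_row _ _ n _ (j, i) (j', i')) => //=.
- by apply: contraNneq nef => -[-> ->].
- by rewrite (swapD (i, j)) coverable_swap.
- by rewrite (swapD (i', j')) coverable_swap.
Qed.

(* A minimal uncoverable subset is a matching by uncrossing. *)
Theorem konig (I J : finType) n (P : {set I * J}) : ~~ coverable n P ->
  exists Q : {set I * J}, [/\ Q \subset P, (n < #|Q|)%N,
    {in Q &, injective fst} & {in Q &, injective snd}].
Proof.
move=> ncP.
have [|Q /minsetP[/andP[sQP ncQ] minQ]] :=
    @ex_minset _ (fun Q => (Q \subset P) && ~~ coverable n Q).
  by exists P; rewrite subxx.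
have cD e : e \in Q -> coverable n (Q :\ e).
  move=> eQ; apply: contraT => nc.
  have /setP/(_ e) : Q :\ e = Q.
    by apply: minQ; rewrite ?subD1set // nc (subset_trans (subD1set _ _) sQP).
  by rewrite !inE eqxx eQ.
have injQ1 : {in Q &, injective fst}.
  move=> e f eQ fQ ef; apply: contraNeq ncQ => nef.
  exact: coverable_uncross_row nef ef (cD e eQ) (cD f fQ).
exists Q; split=> //; last first.
  move=> e f eQ fQ ef; apply: contraNeq ncQ => nef.
  exact: coverable_uncross_col nef ef (cD e eQ) (cD f fQ).
(* With at most n positions, [Q] would be covered by the rows it meets. *)
rewrite ltnNge; apply: contra ncQ => leQ; apply/coverableP.
exists (fst @: Q), set0; split; first by rewrite cards0 addn0 card_in_imset.
by apply/line_coverP => p pQ; rewrite imset_f.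
Qed.

(** * Leading positions and the rank of combinations *)

Section Leading.
Variables (F : fieldType) (k m : nat).
Implicit Types (M : 'M[F]_(k, m)) (V : {vspace 'M[F]_(k, m)}).

Lemma free_rows_rank (T : Type) (h : T -> 'I_k) (s : seq T) M :
  free [seq row (h x) M | x <- s] -> (size s <= \rank M)%N.
Proof.
case: s => [|x0 s0] //; move: (x0 :: s0) => s fr.
pose X := \matrix_(l < size s) row (h (nth x0 s l)) M.
suff /eqP <- : row_free X.
  by apply: mxrankS; apply/row_subP => l; rewrite rowK row_sub.
apply: inj_row_free => v vX; apply/rowP => l; rewrite mxE.
have szs : size [seq row (h x) M | x <- s] == size s by rewrite size_map.
have /freeP/(_ (fun i => v 0 i)) : free (Tuple szs) by [].
apply; rewrite -[RHS]vX mulmx_sum_row; apply: eq_bigr => i _.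
by rewrite rowK /= (nth_map x0).
Qed.

(* The coefficient of the matrix attached to x is chosen in {0, 1} so that its
   row h x leaves the span of the others; later matrices vanish on that row. *)
Lemma free_staircase_from (T : eqType) (h : T -> 'I_k) (A : T -> 'M[F]_(k, m))
    V (s : seq T) d M0 :
  pairwise (fun x y => h x < h y)%N s -> M0 \in V ->
  {in s, forall x, A x \in V} ->
  {in s, forall x (i : 'I_k), (i < h x)%N -> row i (A x) = 0} ->
  free (d ++ [seq row (h x) (A x) | x <- s]) ->
  exists M, [/\ M \in V,
    forall i : 'I_k, {in s, forall x, i < h x}%N -> row i M = row i M0 &
    free (d ++ [seq row (h x) M | x <- s])].
Proof.
elim: s d M0 => [|x s IH] d M0; first by exists M0.
rewrite pairwise_cons => /andP[/allP ltx ps] M0V AV A0.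
rewrite map_cons; set e := map _ s.
have fr_perm v e' : free (d ++ v :: e') = (v \notin <<d ++ e'>>%VS) && free (d ++ e').
  by rewrite -free_cons; apply: perm_free; rewrite perm_catC /= perm_cons perm_catC.
rewrite fr_perm => /andP[nx fre].
have [c nc] : exists c : F, row (h x) (M0 + c *: A x) \notin <<d ++ e>>%VS.
  have [h0|h0] := boolP (row (h x) M0 \in <<d ++ e>>%VS); last first.
    by exists 0; rewrite scale0r addr0.
  exists 1; rewrite scale1r linearD /=; apply: contra nx => h1.
  by have := memvB h1 h0; rewrite addrAC subrr add0r.
have xs : x \in x :: s by rewrite mem_head.
have sub_s y : y \in s -> y \in x :: s by move=> ys; rewrite inE ys orbT.
(* The prefix [d] accumulates the rows of the final matrix that are already settled. *)
have [||||M [MV Mrow Mfr]] :=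
    IH (rcons d (row (h x) (M0 + c *: A x))) (M0 + c *: A x) ps.
- by rewrite memvD // memvZ // AV.
- by move=> y ys; rewrite AV ?sub_s.
- by move=> y ys; apply: A0; rewrite sub_s.
- by rewrite cat_rcons fr_perm nc.
exists M; split=> //.
  move=> i lti; rewrite Mrow => [|y ys]; last by rewrite lti ?sub_s.
  by rewrite linearD linearZ /= A0 ?lti // scaler0 addr0.
by rewrite -cat_rcons (Mrow (h x)) // => y /ltx.
Qed.

Definition leading M (p : 'I_k * 'I_m) :=
  (M p.1 p.2 != 0) && [forall i, forall j,
    (M i j != 0) ==> ((p.1 < i) || ((i == p.1) && (p.2 <= j)))%N].

Lemma leadingP M p : reflect (M p.1 p.2 != 0 /\ forall i j, M i j != 0 ->
    ((p.1 < i) || ((i == p.1) && (p.2 <= j)))%N) (leading M p).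
Proof.
apply: (iffP andP) => -[nz H]; split=> //.
  by move=> i j; move/forallP/(_ i)/forallP/(_ j)/implyP: H.
by apply/forallP => i; apply/forallP => j; apply/implyP; apply: H.
Qed.

Lemma leading_exists M : M != 0 -> exists p, leading M p.
Proof.
move=> nz; have /existsP[[i0 j0] /= ij0] : [exists p, M p.1 p.2 != 0].
  apply: contraR nz; rewrite negb_exists => /forallP H; apply/eqP/matrixP => i j.
  by have /negPn/eqP := H (i, j); rewrite mxE.
pose W p := M p.1 p.2 != 0.
(* The quantity minimised is the row-major index of a position. *)
case: (@arg_minnP _ (i0, j0) W (fun p => p.1 * m + p.2)%N) => // p Wp minp.
exists p; apply/leadingP; split=> // i j nzij.
have /= := minp (i, j) nzij; rewrite -(inj_eq val_inj) /=.
have := ltn_ord j; have := ltn_ord p.2; move: (val j) (val p.2) (val i) (val p.1).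
by move=> a b c d *; case: (ltngtP c d) => //=; nia.
Qed.

(** In a vanishing combination, consider the term with nonzero coefficient whose leading column is
    smallest. The other such terms lead in strictly later columns, hence vanish in this one, and the
    entry there cannot cancel. *)
Lemma leading_free (s : seq ('I_k * 'I_m)) (A : 'I_k * 'I_m -> 'M[F]_(k, m)) :
  uniq s -> {in s &, injective snd} -> {in s, forall p, leading (A p) p} ->
  free [seq row p.1 (A p) | p <- s].
Proof.
case: s => [|p0 s0]; first by rewrite nil_free.
move: (p0 :: s0) => s us inj lead.
have szs : size [seq row p.1 (A p) | p <- s] == size s by rewrite size_map.
suff : free (Tuple szs) by [].
apply/freeP => c /= c0 l; apply/eqP; apply: contraT => cl.
pose q (l : 'I_(size s)) := nth p0 s l.
have qs l' : q l' \in s by rewrite mem_nth.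
case: (@arg_minnP _ l (fun l => c l != 0) (fun l => (q l).2)) => // l1 cl1 minl.
move/rowP/(_ (q l1).2): c0; rewrite summxE mxE (bigD1 l1) //=.
have /leadingP[nz _] := lead _ (qs l1).
rewrite (nth_map p0) // big1 => [|l' nl'].
  by rewrite addr0 !mxE => /eqP; rewrite mulf_eq0 (negPf cl1) (negPf nz).
rewrite (nth_map p0) // !mxE; have [->|cl'] := eqVneq (c l') 0; first by rewrite mul0r.
apply/eqP; rewrite mulf_eq0; apply/orP; right; apply: contraT => nz'.
have /leadingP[_ /(_ _ _ nz')] := lead _ (qs l').
rewrite ltnn eqxx /= => le1; have le2 := minl _ cl'.
have /(inj _ _ (qs _) (qs _))/eqP : (q l').2 = (q l1).2.
  by apply/val_inj/eqP; rewrite eqn_leq le1.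
by rewrite nth_uniq // => /eqP/val_inj eq_l; rewrite eq_l eqxx in nl'.
Qed.

Lemma leading_rows0 M p (i : 'I_k) : leading M p -> (i < p.1)%N -> row i M = 0.
Proof.
case/leadingP => _ H lti; apply/rowP => j; rewrite !mxE; apply/eqP.
by apply: contraT => /H; rewrite -(inj_eq val_inj) /=; lia.
Qed.

(** Sorted by row, the matrices with leading positions in [Q] form a staircase, since each vanishes
    above its leading row. Their leading rows are free by [leading_free], so [free_staircase_from]
    combines them into one matrix. *)
Lemma leading_matching_rank V (Q : {set 'I_k * 'I_m}) :
  {in Q, forall p, exists2 M, M \in V & leading M p} ->
  {in Q &, injective fst} -> {in Q &, injective snd} ->
  exists2 M, M \in V & (#|Q| <= \rank M)%N.
Proof.
move=> QV inj1 inj2.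
have /fin_all_exists[A HA] : forall p, exists M, p \in Q -> M \in V /\ leading M p.
  move=> p; have [/QV[M MV lM]|] := boolP (p \in Q); first by exists M.
  by exists 0.
pose h (p : 'I_k * 'I_m) : nat := p.1.
pose s := sort (relpre h leq) (enum Q).
have ms p : (p \in s) = (p \in Q) by rewrite mem_sort mem_enum.
have us : uniq s by rewrite sort_uniq enum_uniq.
have ps : pairwise (fun p q : 'I_k * 'I_m => p.1 < q.1)%N s.
  rewrite -[pairwise _ _](pairwise_map h ltn) -sorted_pairwise; last exact: ltn_trans.
  rewrite ltn_sorted_uniq_leq sorted_map sort_sorted ?andbT.
    by rewrite map_inj_in_uniq // => p q; rewrite !ms => pQ qQ /val_inj; apply: inj1.
  by move=> p q; apply: leq_total.
have [|||M [MV _ /free_rows_rank]] :=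
    @free_staircase_from _ fst A V s [::] 0 ps (mem0v _).
- by move=> p; rewrite ms => /HA[].
- by move=> p; rewrite ms => /HA[_ lp] i; apply: leading_rows0.
- apply: leading_free => // [p q|p]; rewrite !ms; first exact: inj2.
  by case/HA.
by rewrite size_sort -cardE => le; exists M.
Qed.

End Leading.

(** * Spaces of matrices determined by freely prescribed rows *)

Section RowDetermined.
Variable F : fieldType.

(** Stability of the lines of the basis vectors makes [T] diagonal; stability of the line of e_i +
    e_0 equates the diagonal entries i and 0. *)
Lemma scalar_mx_of_stable_lines n (T : 'M[F]_n) :
  (forall x : 'rV_n, (x *m T <= x)%MS) -> exists c, T = c%:M.
Proof.
case: n T => [|n] T sT; first by exists 0; apply/matrixP => -[].
have diag i j : i != j -> T i j = 0.
  move=> ij; have /sub_rVP[c /rowP/(_ j)] := sT (delta_mx 0 i).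
  by rewrite -rowE !mxE eqxx [j == i]eq_sym (negPf ij) mulr0.
exists (T 0 0); apply/matrixP => i j; rewrite mxE.
have [<-|/diag //] := eqVneq i j; rewrite mulr1n.
have [-> //|i0] := eqVneq i 0.
have /sub_rVP[c /rowP e] := sT (delta_mx 0 i + delta_mx 0 0).
move: (e i) (e 0); rewrite mulmxDl -!rowE !mxE !eqxx /= [0 == i]eq_sym (negPf i0) /=.
rewrite (diag _ _ i0) [T 0 i]diag 1?eq_sym // !(add0r, addr0, mulr1).
by move=> -> ->.
Qed.

Lemma row_free_pair n (x z : 'rV[F]_n) :
  x != 0 -> ~~ (z <= x)%MS -> row_free (col_mx x z).
Proof.
move=> x0 zx; apply: inj_row_free => v.
rewrite -[v]hsubmxK mul_row_col.
rewrite [lsubmx v]mx11_scalar [rsubmx v]mx11_scalar !mul_scalar_mx.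
set a := lsubmx v 0 0; set b := rsubmx v 0 0 => e.
have [b0|b0] := eqVneq b 0; last first.
  case/negP: zx; apply/sub_rVP; exists (- (b^-1 * a)).
  move/eqP: e; rewrite addrC addr_eq0 => /eqP/(congr1 (fun y => b^-1 *: y)).
  by rewrite scalerK // scalerN scalerA scaleNr.
move: e; rewrite b0 scale0r addr0 => /eqP; rewrite scaler_eq0 (negPf x0) orbF.
by move/eqP->; rewrite !raddf0 row_mx0.
Qed.

(** The map sending e_i to x and e_j to z preserves the independence of the pair, so it extends to
    an automorphism. *)
Lemma unitmx_with_two_rows n (x z : 'rV[F]_n) (i j : 'I_n) :
  x != 0 -> ~~ (z <= x)%MS -> i != j ->
  exists2 Q, Q \in unitmx & row i Q = x /\ row j Q = z.
Proof.
move=> x0 zx ij.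
pose U : 'M[F]_(1 + 1, n) := col_mx (delta_mx 0 i) (delta_mx 0 j).
pose f : 'M[F]_n := delta_mx i (0 : 'I_1) *m x + delta_mx j (0 : 'I_1) *m z.
have Uf : U *m f = col_mx x z.
  rewrite mul_col_mx /f !mulmxDr !mulmxA !mul_delta_mx_cond !eqxx.
  rewrite [j == i]eq_sym (negPf ij) /= !mulr0n !mulr1n !mul0mx addr0 add0r.
  by rewrite -[delta_mx 0 0]mulmx1 -rowE !row1 -!rowE !row_id.
have freeU : row_free U.
  apply: row_free_pair.
    by apply/negP => /eqP/rowP/(_ i)/eqP; rewrite !mxE !eqxx oner_eq0.
  apply/negP => /sub_rVP[c /rowP/(_ j)/eqP].
  by rewrite !mxE !eqxx [j == i]eq_sym (negPf ij) mulr0 oner_eq0.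
have [|Q uQ eQ] := @complete_unitmx _ _ _ U f.
  by rewrite Uf (eqP freeU); apply/eqP/row_free_pair.
exists Q => //; move: eQ; rewrite Uf mul_col_mx -!rowE => /eq_col_mx[-> ->].
by [].
Qed.

Lemma dim_fullmx a b : \dim (fullv : {vspace 'M[F]_(a, b)}) = (a * b)%N.
Proof. by rewrite dimvf; apply: dim_matrix. Qed.

Variables k m : nat.

(** These are the matrices whose columns lie in the column space of [U]. The hypothesis [row_full U]
    used with it says that the columns of [U] are independent, so that [U] has a left inverse. *)
Definition colspace_code r (U : 'M[F]_(k, r)) : {vspace 'M[F]_(k, m)} :=
  limg (linfun (mulmx U : 'M[F]_(r, m) -> 'M[F]_(k, m))).

Lemma mem_colspace_code r (U : 'M[F]_(k, r)) M :
  reflect (exists N, M = U *m N) (M \in colspace_code U).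
Proof.
apply: (iffP memv_imgP) => [[N _ ->]|[N ->]]; exists N; rewrite ?memvf //.
  by rewrite lfunE.
by rewrite lfunE.
Qed.

(* For row-free N the prescribed rows already span the row space of the unique
   M in V extending N, so each further row, a linear function g of N, lies in
   the row space of N. Moving one row of N inside that row space shows that
   each component of g preserves every line, hence is scalar. *)
Lemma row_determined_colspace_code (V : {vspace 'M[F]_(k, m)}) R (f : 'I_R -> 'I_k) :
  injective f -> (k <= m)%N -> \dim V = (m * R)%N ->
  {in V, forall M, (\rank M <= R)%N} ->
  {in V, forall M, rowsub f M = 0 -> M = 0} ->
  exists2 U : 'M[F]_(k, R), row_full U & V = colspace_code U.
Proof.
move=> injf km dimV rkV detV.
pose phi : 'Hom('M[F]_(k, m), 'M[F]_(R, m)) := linfun (rowsub f).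
pose G := (phi \o projv V)%VF.
(* By [detV], [phi] is injective on [V]; since [V] has the dimension of the target, it is also
   onto. *)
have fullG : limg G = fullv.
  rewrite limg_comp limg_proj; apply/eqP; rewrite -(dimv_leqif_eq (subvf _)).
  rewrite dim_fullmx [X in X == _]limg_dim_eq; first by rewrite dimV mulnC.
  apply/eqP; rewrite -subv0; apply/subvP => M; rewrite memv_cap memv_ker memv0.
  by case/andP=> MV; rewrite lfunE => /eqP/(detV _ MV) ->.
(* [psi N] is the element of [V] whose rows along [f] form [N]. *)
pose psi := (projv V \o G^-1)%VF.
have psiV N : psi N \in V by rewrite comp_lfunE memv_proj.
have psiK N : rowsub f (psi N) = N.
  have := @limg_lfunVK _ _ _ G N; rewrite fullG memvf => /(_ isT).
  by rewrite !comp_lfunE lfunE.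
have rowN i N : row_free N -> (row i (psi N) <= N)%MS.
  move=> frN; apply: submx_trans (row_sub i _) _.
  have sN : (N <= psi N)%MS.
    by rewrite -{1}[N]psiK; apply/row_subP => l; rewrite row_rowsub row_sub.
  have := mxrank_leqif_sup sN; rewrite (eqP frN) => -[_ <-].
  by rewrite eqn_leq rkV // -{1}(eqP frN) mxrankS.
have comb i : exists u : 'rV[F]_R, (forall N, row i (psi N) = u *m N) /\
    (forall l, i = f l -> u = delta_mx 0 l).
  have [/codomP[l ->]|nfi] := boolP (i \in codom f).
    exists (delta_mx 0 l); split=> [N|l' /injf -> //].
    by rewrite -rowE -{2}[N]psiK row_rowsub.
  (* A row [i] outside the image of [f] forces R < k <= m; the spare index R becomes [j] below. *)
  have ltRm : (R < m)%N.
    apply: leq_trans km; rewrite -[R]card_ord -(card_codom injf) -[k in (_ < k)%N]card_ord.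
    by apply: proper_card; apply/properP; split; [apply/subsetP|exists i].
  (* [T l] sends x to row [i] of the extension of the matrix with x in row [l] and zeros
     elsewhere. *)
  pose T l := lin1_mx (row i \o psi \o mulmx (delta_mx l (0 : 'I_1))).
  have TE l x : x *m T l = row i (psi (delta_mx l 0 *m x)) by rewrite mul_rV_lin1.
  have stab l (x : 'rV_m) : (x *m T l <= x)%MS.
    have [->|x0] := eqVneq x 0; first by rewrite mul0mx sub0mx.
    apply: contraT; set z := x *m T l => zx.
    pose sg : 'I_R -> 'I_m := widen_ord (ltnW ltRm).
    have injsg : injective sg by move=> a b /(congr1 val)/= /val_inj.
    pose j : 'I_m := Ordinal ltRm.
    have sgj a : sg a != j by rewrite -(inj_eq val_inj) /= ltn_eqF.
    (* Complete x and z to a basis with x at place [l'] and z at place R; the first R vectors are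
       the rows of [N]. *)
    have main l' : exists N : 'M[F]_(R, m), [/\ row_free N, row l' N = x & ~~ (z <= N)%MS].
      have [Q uQ [Qx Qz]] := unitmx_with_two_rows x0 zx (sgj l').
      exists (rowsub sg Q); split; last 1 first.
      - apply/negP; rewrite -Qz rowsubE => /submxP[w].
        rewrite mulmxA rowE => /(can_inj (mulmxK uQ))/rowP/(_ j).
        rewrite !mxE !eqxx big1 => [/eqP|a _]; first by rewrite oner_eq0.
        by rewrite !mxE (negPf (sgj a)) mulr0.
      - apply/row_freeP; exists (invmx Q *m colsub sg 1%:M).
        rewrite rowsubE -mulmxA (mulKVmx uQ); apply/matrixP => a b.
        rewrite !mxE (bigD1 (sg a)) //= big1 ?addr0 => [|c nc].
          by rewrite !mxE eqxx mul1r (inj_eq injsg).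
        by rewrite !mxE eq_sym (negPf nc) mul0r.
      - by rewrite row_rowsub.
    (* [D] is invertible and adds row [l'] of [N], which is x, to row [l]. Thus z is a difference of
       two vectors in the row space of [N], a contradiction. *)
    have [/existsP[l' nl]|] := boolP [exists l', l' != l].
      have [N [frN Nx /negP[]]] := main l'.
      pose D := 1%:M + delta_mx l l' : 'M[F]_R.
      have DN : D *m N = N + delta_mx l 0 *m x.
        rewrite mulmxDl mul1mx; congr (_ + _).
        by rewrite -[delta_mx l l'](mul_delta_mx (0 : 'I_1)) -mulmxA -rowE Nx.
      have frD : row_free (D *m N).
        have /row_freeP[B NB] := frN; apply/row_freeP.
        exists (B *m (1%:M - delta_mx l l')).
        rewrite mulmxA -(mulmxA D) NB mulmx1 mulmxDl mul1mx mulmxBr mulmx1.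
        by rewrite mul_delta_mx_0 // subr0 subrK.
      have -> : z = row i (psi (D *m N)) - row i (psi N).
        by rewrite DN /z TE !linearD /= addrAC subrr add0r.
      rewrite addmx_sub ?eqmx_opp ?rowN //.
      by apply: submx_trans (rowN i _ frD) (submxMl _ _).
    (* Here [l] is the only index, and [N] itself has x as its single row. *)
    rewrite negb_exists => /forallP all_l.
    have [N [frN Nx /negP[]]] := main l.
    suff -> : z = row i (psi N) by apply: rowN.
    rewrite /z TE; congr (row i (psi _)); apply/row_matrixP => a.
    have /negPn/eqP -> := all_l a.
    by rewrite Nx row_mul rowE mul_delta_mx -[delta_mx 0 0]mulmx1 -rowE row1 -rowE row_id.
  have /fin_all_exists[c Tc] l := scalar_mx_of_stable_lines (stab l).
  exists (\row_l c l); split=> [N|l eil]; last first.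
    by rewrite eil codom_f in nfi.
  have {1}-> : N = \sum_l delta_mx l (0 : 'I_1) *m row l N.
    rewrite -[LHS]mul1mx mx1_sum_delta.
    rewrite mulmx_suml; apply: eq_bigr => l _.
    by rewrite -(mul_delta_mx (0 : 'I_1)) -mulmxA -rowE.
  rewrite !linear_sum mulmx_sum_row; apply: eq_bigr => l _.
  by transitivity (row l N *m T l); [rewrite TE | rewrite Tc mul_mx_scalar mxE].
have [u Hu] := fin_all_exists comb.
pose U := \matrix_i u i.
have psiE N : psi N = U *m N.
  by apply/row_matrixP => i; rewrite row_mul rowK; case: (Hu i).
exists U.
  apply/row_fullP; exists (rowsub f 1%:M); rewrite -rowsubE.
  apply/row_matrixP => l; rewrite row_rowsub rowK row1.
  by case: (Hu (f l)) => _; apply.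
apply/vspaceP => M; apply/idP/mem_colspace_code => [MV|[N ->]]; last by rewrite -psiE.
exists (rowsub f M); rewrite -psiE; apply/eqP; rewrite -subr_eq0; apply/eqP.
by apply: detV; rewrite ?memvB // linearB /= psiK subrr.
Qed.

End RowDetermined.

(** * Optimal anticodes and their leading positions *)

Section Anticodes.
Variables (F : finFieldType) (k m : nat).
Implicit Types (A C V : {vspace 'M[F]_(k, m)}).

Lemma rank_le_maxrk V : {in V, forall M, (\rank M <= maxrk V)%N}.
Proof. by move=> M MV; apply: (bigop.bigmax_sup M). Qed.

Lemma maxrk_eq V r : {in V, forall M, (\rank M <= r)%N} ->
  (exists2 M, M \in V & \rank M = r) -> maxrk V = r.
Proof.
move=> le_r [M MV rM]; apply/eqP; rewrite eqn_leq -{2}rM rank_le_maxrk // andbT.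
exact/bigop.bigmax_leqP.
Qed.

Lemma dim_colspace_code r (U : 'M[F]_(k, r)) : row_full U ->
  \dim (colspace_code m U) = (r * m)%N.
Proof.
move=> /row_fullP[B BU]; rewrite /colspace_code limg_dim_eq ?dim_fullmx //.
apply/eqP; rewrite -subv0; apply/subvP => N; rewrite memv_cap memv_ker memv0.
case/andP=> _; rewrite lfunE => /eqP/(congr1 (mulmx B)).
by rewrite mulmxA BU mul1mx mulmx0 => ->.
Qed.

Lemma maxrk_colspace_code r (U : 'M[F]_(k, r)) : row_full U -> (r <= m)%N ->
  maxrk (colspace_code m U) = r.
Proof.
move=> /row_fullP[B BU] le_rm; apply: maxrk_eq.
  move=> _ /mem_colspace_code[N ->]; apply: leq_trans (mxrankM_maxr _ _) _.
  exact: rank_leq_row.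
(* As r <= m, some r by m matrix has rank r, and [U], having a left inverse, preserves it. *)
have rN : \rank (pid_mx r : 'M[F]_(r, m)) = r by rewrite rank_pid_mx.
exists (U *m pid_mx r); first by apply/mem_colspace_code; exists (pid_mx r).
apply/eqP; rewrite eqn_leq -{4}rN (leq_trans (mxrankM_maxr _ _)) ?rN //=.
by rewrite -{1}rN -[pid_mx r in leqLHS]mul1mx -BU -mulmxA mxrankM_maxr.
Qed.

Lemma colspace_code_optimal r (U : 'M[F]_(k, r)) : row_full U -> (r <= m)%N ->
  is_optimal_anticode (colspace_code m U).
Proof.
move=> fullU le_rm.
by rewrite /is_optimal_anticode dim_colspace_code // maxrk_colspace_code // mulnC.
Qed.

Lemma fullv_optimal : (k <= m)%N ->
  is_optimal_anticode (fullv : {vspace 'M[F]_(k, m)}).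
Proof.
move=> km; suff -> : fullv = colspace_code m (1%:M : 'M[F]_k).
  by apply: colspace_code_optimal; rewrite // row_full_unit unitmx1.
apply/vspaceP => M; rewrite memvf; apply/esym/mem_colspace_code.
by exists M; rewrite mul1mx.
Qed.

(** Multiplying [U] by [pid_mx r] drops its last column. *)
Lemma colspace_code_chain r (U : 'M[F]_(k, r.+1)) : row_full U -> (r < m)%N ->
  exists A, [/\ is_optimal_anticode A, (A <= colspace_code m U)%VS &
    (\dim A + m)%N = \dim (colspace_code m U)].
Proof.
move=> fullU ltrm; have fullU' : row_full (U *m (pid_mx r : 'M_(r.+1, r))).
  have /row_fullP[B BU] := fullU; apply/row_fullP.
  exists (pid_mx r *m B); rewrite -mulmxA (mulmxA B) BU mul1mx mul_pid_mx.
  by rewrite minnn (minn_idPr (leqnSn r)) pid_mx_1.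
exists (colspace_code m (U *m (pid_mx r : 'M_(r.+1, r)))); split.
- by apply: colspace_code_optimal; rewrite // ltnW.
- apply/subvP => _ /mem_colspace_code[N ->]; apply/mem_colspace_code.
  by exists ((pid_mx r : 'M_(r.+1, r)) *m N); rewrite mulmxA.
- by rewrite !dim_colspace_code // addnC.
Qed.

(** Evaluation at the positions of [S] is linear and injective on [V]. *)
Lemma dim_le_determining_card V (S : {set 'I_k * 'I_m}) :
  {in V, forall M : 'M[F]_(k, m), {in S, forall p, M p.1 p.2 = 0} -> M = 0} ->
  (\dim V <= #|S|)%N.
Proof.
move=> detS; pose ix (l : 'I_#|S|) := mxvec_index (enum_val l).1 (enum_val l).2.
pose ev : 'Hom('M[F]_(k, m), 'rV[F]_#|S|) := linfun (colsub ix \o mxvec).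
rewrite -(limg_dim_eq (f := ev)); last first.
  apply/eqP; rewrite -subv0; apply/subvP => M; rewrite memv_cap memv_ker memv0.
  case/andP=> MV; rewrite lfunE /= => /eqP/rowP ev0; apply/eqP/detS => // p pS.
  have := ev0 (enum_rank_in pS p).
  by rewrite !mxE /ix (enum_rankK_in pS pS) mxvecE.
by apply: leq_trans (dimvS (subvf _)) _; rewrite dim_fullmx mul1n.
Qed.

Definition leading_positions V : {set 'I_k * 'I_m} :=
  [set p | [exists M, (M \in V) && leading M p]].

Lemma leading_positionsP V p :
  reflect (exists2 M, M \in V & leading M p) (p \in leading_positions V).
Proof.
rewrite inE; apply: (iffP existsP) => [[M /andP[]]|[M MV lM]]; exists M => //.
exact/andP.
Qed.

Lemma leading_positions_determine V :
  {in V, forall M : 'M[F]_(k, m),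
    {in leading_positions V, forall p, M p.1 p.2 = 0} -> M = 0}.
Proof.
move=> M MV M0; apply/eqP; apply: contraT => /leading_exists[p lp].
have /leadingP[/eqP[]] := lp.
by apply: M0; apply/leading_positionsP; exists M.
Qed.

(** Here a rows and b columns cover a set of at least mR positions. The inequalities give m b <= (k
    - a) b, so a single column among the lines already forces a = 0 and k = m. *)
Lemma line_count R a b : (0 < k)%N -> (k <= m)%N -> (a <= k)%N ->
  (a + b <= R)%N -> (m * R <= a * m + (k - a) * b)%N ->
  (b = 0 /\ a = R)%N \/ [/\ a = 0%N, b = R & k = m].
Proof.
move=> k0 km ak abR le_mR.
have [b0|b_gt0] := posnP b.
  have : (m * R <= m * a)%N by nia.
  by rewrite leq_pmul2l ?(leq_trans k0) // => Ra; left; lia.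
have : (m * b <= (k - a) * b)%N by nia.
rewrite leq_pmul2r // => mka; have a0 : a = 0%N by lia.
have : (m * R <= m * b)%N by nia.
rewrite leq_pmul2l ?(leq_trans k0) // => Rb; right; split; lia.
Qed.

Lemma optimal_anticode_lines V : (0 < k)%N -> (k <= m)%N ->
  is_optimal_anticode V ->
  (exists2 S : {set 'I_k}, #|S| = maxrk V &
     {in leading_positions V, forall p, p.1 \in S}) \/
  (k = m /\ exists2 S : {set 'I_m}, #|S| = maxrk V &
     {in leading_positions V, forall p, p.2 \in S}).
Proof.
move=> k0 km optV; set R := maxrk V; set P := leading_positions V.
have dimP : (m * R <= #|P|)%N.
  by rewrite -optV; apply: dim_le_determining_card; apply: leading_positions_determine.
have /coverableP[A [B [leAB /line_coverP cov]]] : coverable R P.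
  apply: contraT => /konig[Q [/subsetP sQP ltQ inj1 inj2]].
  have [|M MV rM] := leading_matching_rank _ inj1 inj2 (V := V).
    by move=> p /sQP/leading_positionsP.
  by have := rank_le_maxrk MV; rewrite leqNgt (leq_trans ltQ rM).
(* The rows of [A] are counted in full, the columns of [B] only outside these rows. *)
have leP : (#|P| <= #|A| * m + (k - #|A|) * #|B|)%N.
  have -> : (k - #|A| = #|~: A|)%N by rewrite [RHS]cardsCs setCK card_ord.
  have -> : (#|A| * m = #|A| * #|[set: 'I_m]|)%N by rewrite cardsT card_ord.
  rewrite -!cardsX; apply: leq_trans (leq_card_setU _ _).
  apply/subset_leq_card/subsetP => -[i j] /cov /=; rewrite !inE /=.
  by case: (i \in A).
have leA : (#|A| <= k)%N by rewrite -[leqRHS]card_ord max_card.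
case: (line_count k0 km leA leAB (leq_trans dimP leP)) => [[B0 AR]|[A0 BR ekm]].
  by left; exists A => // p /cov; rewrite (cards0_eq B0) inE orbF.
by right; split=> //; exists B => // p /cov; rewrite (cards0_eq A0) inE.
Qed.

End Anticodes.

(** * Descending by codimension m inside an optimal anticode *)

Lemma row_determined_chain (F : finFieldType) k m (V : {vspace 'M[F]_(k, m)})
    (S : {set 'I_k}) : (k <= m)%N -> (0 < #|S|)%N -> \dim V = (m * #|S|)%N ->
  {in V, forall M, (\rank M <= #|S|)%N} ->
  {in V, forall M, {in S, forall i, row i M = 0} -> M = 0} ->
  exists A, [/\ is_optimal_anticode A, (A <= V)%VS & (\dim A + m)%N = \dim V].
Proof.
move=> km S0 dimV rkV detV.
have [|U fullU ->] := @row_determined_colspace_code F k m V _ (enum_val : 'I_#|S| -> _)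
  enum_val_inj km dimV rkV.
- move=> M MV M0; apply: detV => // i iS.
  have := congr1 (row (enum_rank_in iS i)) M0.
  by rewrite row_rowsub (enum_rankK_in iS iS) linear0.
have leS : (#|S| <= m)%N by rewrite (leq_trans _ km) // -[leqRHS]card_ord max_card.
by case: #|S| S0 leS U fullU => // r _ ltrm U fullU; apply: colspace_code_chain.
Qed.

Definition trcode (F : fieldType) k m (V : {vspace 'M[F]_(k, m)}) :
    {vspace 'M[F]_(m, k)} :=
  (linfun (trmx : 'M[F]_(k, m) -> 'M[F]_(m, k)) @: V)%VS.

Lemma mem_trcode (F : fieldType) k m (V : {vspace 'M[F]_(k, m)}) M :
  (M \in trcode V) = (M^T \in V).
Proof.
apply/memv_imgP/idP => [[N NV ->]|MV]; first by rewrite lfunE /= trmxK.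
by exists M^T; rewrite // lfunE /= trmxK.
Qed.

Lemma dim_trcode (F : fieldType) k m (V : {vspace 'M[F]_(k, m)}) :
  \dim (trcode V) = \dim V.
Proof.
rewrite /trcode limg_dim_eq //; apply/eqP; rewrite -subv0; apply/subvP => M.
rewrite memv_cap memv_ker memv0 => /andP[_]; rewrite lfunE /=.
by move/eqP/(congr1 trmx); rewrite trmxK trmx0 => ->.
Qed.

Lemma maxrk_trcode (F : finFieldType) k m (V : {vspace 'M[F]_(k, m)}) :
  maxrk (trcode V) = maxrk V.
Proof.
rewrite /maxrk (reindex (@trmx F k m)) /=; last first.
  by exists (@trmx F m k) => M _; apply: trmxK.
by apply: eq_big => M; rewrite ?mem_trcode ?trmxK // mxrank_tr.
Qed.

Theorem optimal_anticode_chain (F : finFieldType) k m (V : {vspace 'M[F]_(k, m)}) :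
  (0 < k)%N -> (k <= m)%N -> is_optimal_anticode V -> (0 < maxrk V)%N ->
  exists A, [/\ is_optimal_anticode A, (A <= V)%VS & (\dim A + m)%N = \dim V].
Proof.
move=> k0 km optV R0.
case: (optimal_anticode_lines k0 km optV) => [[S cS PS]|[ekm [S cS PS]]].
  apply: (row_determined_chain (S := S)); rewrite ?cS //.
    exact: rank_le_maxrk.
  move=> M MV M0; apply: leading_positions_determine (MV) _ => p /PS/M0.
  by move/rowP/(_ p.2); rewrite !mxE.
(* Since k = m, transposition stays within square matrices and turns the columns of [S] into rows;
   the anticode found is transposed back. *)
move: ekm V km k0 optV R0 S cS PS => <- V km k0 optV R0 S cS PS {m}.
have [|||||A [optA sAV dimA]] := @row_determined_chain F k k (trcode V) S;
  rewrite ?cS ?dim_trcode //.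
- by rewrite -(maxrk_trcode V); apply: rank_le_maxrk.
- move=> M; rewrite mem_trcode => MV M0; apply: (can_inj (@trmxK _ _ _)).
  rewrite trmx0; apply: leading_positions_determine (MV) _ => p /PS/M0.
  by move/rowP/(_ p.1); rewrite !mxE.
exists (trcode A); split; rewrite /is_optimal_anticode ?maxrk_trcode ?dim_trcode //.
- by apply/subvP => M; rewrite mem_trcode => /(subvP sAV); rewrite mem_trcode trmxK.
- by rewrite dimA dim_trcode.
Qed.

(** * Generalized weights as minimal anticode dimensions *)

Section GeneralizedWeights.
Variables (F : finFieldType) (k m : nat).
Implicit Types (A C V : {vspace 'M[F]_(k, m)}).

Lemma big_minn_le (I : finType) (P : pred I) (f : I -> nat) d i :
  P i -> (\big[minn/d]_(j | P j) f j <= f i)%N.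
Proof. exact: (@bigmin_le_cond _ nat). Qed.

Lemma big_minn_attained (I : finType) (P : pred I) (f : I -> nat) d :
  \big[minn/d]_(j | P j) f j = d \/
  exists2 i, P i & \big[minn/d]_(j | P j) f j = f i.
Proof.
apply: (big_ind (fun x => x = d \/ exists2 i, P i & x = f i)); first by left.
  by move=> x y hx hy; rewrite /minn; case: ifP.
by move=> i Pi; right; exists i.
Qed.

Lemma min_anticode_dim_le C r A :
  is_optimal_anticode A -> (r <= \dim (A :&: C))%N ->
  (min_anticode_dim C r <= \dim A)%N.
Proof.
move=> optA rA; have ltA : (\dim A < (k * m).+1)%N.
  by rewrite ltnS -(dim_fullmx F) dimvS ?subvf.
apply: (@big_minn_le 'I_(k * m).+1 _ val _ (Ordinal ltA)).
by apply/asboolP; exists A.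
Qed.

Lemma min_anticode_dim_attained C r : (k <= m)%N -> (r <= \dim C)%N ->
  exists A, [/\ is_optimal_anticode A, (r <= \dim (A :&: C))%N &
    \dim A = min_anticode_dim C r].
Proof.
move=> km rC; rewrite /min_anticode_dim.
case: (@big_minn_attained 'I_(k * m).+1
  (fun n => `[< exists A, [/\ is_optimal_anticode A, (r <= \dim (A :&: C))%N
     & \dim A = n] >]) val (k * m)) => [->|[n /asboolP[A [optA rA dA]] ->]].
  (* The default value k m is the dimension of the full space, which is itself an admissible
     anticode. *)
  exists fullv; split; [exact: fullv_optimal | | exact: dim_fullmx].
  by rewrite capfv.
by exists A.
Qed.

Lemma min_anticode_dim_monotone C r r' : (k <= m)%N -> (r <= r')%N ->
  (r' <= \dim C)%N -> (min_anticode_dim C r <= min_anticode_dim C r')%N.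
Proof.
move=> km rr' /(min_anticode_dim_attained km)[A [optA rA <-]].
exact: min_anticode_dim_le optA (leq_trans rr' rA).
Qed.

Lemma min_anticode_dim_full C r : (k <= m)%N -> (r <= \dim C)%N ->
  (min_anticode_dim C r <= k * m)%N.
Proof.
move=> km rC; rewrite -(dim_fullmx F); apply: min_anticode_dim_le.
  exact: fullv_optimal.
by rewrite capfv.
Qed.

(** If [V] attains the value at r + m, an optimal anticode of codimension m in [V] loses at most m
    dimensions of the intersection with [C], so it is admissible for r. *)
Lemma min_anticode_dim_strict C r : (0 < k)%N -> (k <= m)%N ->
  (r + m <= \dim C)%N -> (min_anticode_dim C r < min_anticode_dim C (r + m))%N.
Proof.
move=> k0 km /(min_anticode_dim_attained km)[V [optV rV <-]].
have m0 : (0 < m)%N by apply: leq_trans km.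
(* Otherwise [V] would be zero, whereas it meets [C] in dimension at least r + m > 0. *)
have R0 : (0 < maxrk V)%N.
  have := dimvS (capvSl V C); rewrite optV; case: (maxrk V) => [|//]; lia.
have [A [optA sAV dimA]] := optimal_anticode_chain k0 km optV R0.
have le_r : (r <= \dim (A :&: C))%N.
  have := dimv_sum_cap A (V :&: C); rewrite capvA (capv_idPl sAV).
  have : (\dim (A + (V :&: C)) <= \dim V)%N by rewrite dimvS // subv_add sAV capvSl.
  lia.
by have := min_anticode_dim_le optA le_r; lia.
Qed.

(** The matrices supported on the first k - s rows have codimension s m, hence meet [C] in dimension
    at least dim C - s m. *)
Lemma min_anticode_dim_singleton C r s : (k <= m)%N -> (s <= k)%N ->
  (r + s * m <= \dim C)%N -> (min_anticode_dim C r <= (k - s) * m)%N.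
Proof.
move=> km sk rs.
pose U : 'M[F]_(k, k - s) := pid_mx (k - s).
have fullU : row_full U by rewrite /row_full rank_pid_mx // leq_subr.
rewrite -(dim_colspace_code m fullU); apply: min_anticode_dim_le.
  by apply: colspace_code_optimal; rewrite // (leq_trans (leq_subr _ _)).
rewrite -(leq_add2l (\dim (colspace_code m U + C)%VS)) dimv_sum_cap.
have le_km : (\dim (colspace_code m U + C) <= k * m)%N.
  by rewrite -(dim_fullmx F) dimvS ?subvf.
apply: leq_trans (leq_add le_km (leqnn r)) _.
by rewrite dim_colspace_code // -{1}(subnK sk) mulnDl -addnA leq_add2l addnC.
Qed.

(** Divisibility by m makes the weight an integer, which is what improves the bound r/m to its
    ceiling. *)
Lemma min_anticode_dim_ge C r : (k <= m)%N -> (r <= \dim C)%N ->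
  exists2 R, min_anticode_dim C r = (m * R)%N & (r <= m * R)%N.
Proof.
move=> km /(min_anticode_dim_attained km)[A [optA rA <-]].
exists (maxrk A) => //; rewrite -optA.
exact: leq_trans rA (dimvS (capvSl _ _)).
Qed.

Lemma minrk_attained C : (0 < \dim C)%N ->
  exists2 M, M \in C & (0 < \rank M)%N /\ \rank M = minrk C.
Proof.
move=> C0; have [M0 M0C M0n] : exists2 M, M \in C & M != 0.
  by exists (vpick C); rewrite ?memv_pick // vpick0 -dimv_eq0 -lt0n.
have rM0 : (0 < \rank M0)%N by rewrite lt0n mxrank_eq0.
rewrite /minrk; case: (@big_minn_attained 'M[F]_(k, m)
  (fun M => (M \in C) && (0 < \rank M)%N) (fun M => \rank M) k) => [e|[M /andP[]]].
  (* If the minimum equals the default k, then [M0] attains it, its rank being both at least the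
     minimum and at most k. *)
  exists M0 => //; split=> //; apply/eqP; rewrite eqn_leq.
  rewrite [X in _ && X](@big_minn_le 'M[F]_(k, m)) ?M0C // e andbT.
  exact: rank_leq_row.
by exists M.
Qed.

(** For the upper bound, take the matrices with columns in the column space of a codeword of minimal
    rank. Conversely, an anticode meeting [C] nontrivially contains a nonzero codeword, so its
    maximal rank is at least [minrk C]. *)
Lemma min_anticode_dim1 C : (k <= m)%N -> (0 < \dim C)%N ->
  min_anticode_dim C 1 = (m * minrk C)%N.
Proof.
move=> km C0; apply/eqP; rewrite eqn_leq; apply/andP; split.
  have [M MC [rM eM]] := minrk_attained C0.
  have fullU := col_base_full M.
  rewrite -eM mulnC -(dim_colspace_code m fullU); apply: min_anticode_dim_le.
    by apply: colspace_code_optimal; rewrite ?rank_leq_col.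
  rewrite lt0n dimv_eq0; apply: contraTneq rM => e0.
  suff : M \in (colspace_code m (col_base M) :&: C)%VS.
    by rewrite e0 memv0 => /eqP->; rewrite mxrank0.
  rewrite memv_cap MC andbT; apply/mem_colspace_code; exists (row_base M).
  by rewrite mulmx_base.
have [A [optA A1 <-]] := min_anticode_dim_attained km C0.
rewrite optA leq_mul2l; apply/orP; right.
pose M := vpick (A :&: C).
have M0 : M != 0 by rewrite vpick0 -dimv_eq0 -lt0n.
have /andP[MA MC] : (M \in A) && (M \in C) by rewrite -memv_cap memv_pick.
apply: leq_trans (rank_le_maxrk MA).
by apply: big_minn_le; rewrite MC lt0n mxrank_eq0.
Qed.

End GeneralizedWeights.

Theorem theorem6p2 (F : finFieldType) (k m : nat) (C : {vspace 'M[F]_(k, m)}) :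
  (1 <= k)%N -> (k <= m)%N -> (1 <= \dim C)%N ->
  let t := \dim C in
  let a := delsarte_gw C in
  (a 1%N = (minrk C)%:R) /\
      (a t <= k%:R) /\
      (forall r : nat, (1 <= r)%N -> (r <= t - 1)%N -> a r <= a r.+1) /\
      (forall r : nat, (1 <= r)%N -> (r + m <= t)%N -> a r < a (r + m)%N) /\
      (forall r : nat, (1 <= r)%N -> (r <= t)%N ->
          a r <= k%:R - (Num.floor ((t - r)%:R / m%:R : rat))%:~R) /\
     (forall r : nat, (1 <= r)%N -> (r <= t)%N ->
          a r >= (Num.ceil (r%:R / m%:R : rat))%:~R).
Proof.
move=> k0 km C0 t a.
have m0 : 0 < m%:R :> rat by rewrite ltr0n (leq_trans k0).
have mn0 : (0 < m)%N by rewrite -(ltr0n rat).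
have dimC : (t <= k * m)%N by rewrite -(dim_fullmx F) dimvS ?subvf.
split; [|split; [|split; [|split; [|split]]]].
- by rewrite /a /delsarte_gw min_anticode_dim1 // natrM mulrC mulKf ?gt_eqF.
- by rewrite ler_pdivrMr // -natrM ler_nat min_anticode_dim_full.
- move=> r r1 rt; rewrite ler_pM2r ?invr_gt0 // ler_nat.
  by apply: min_anticode_dim_monotone => //; rewrite -/t; lia.
- move=> r r1 rt; rewrite ltr_pM2r ?invr_gt0 // ltr_nat.
  exact: min_anticode_dim_strict.
- move=> r r1 rt; pose s := ((t - r) %/ m)%N.
  have floorE : Num.floor ((t - r)%:R / m%:R : rat) = s%:Z.
    apply: floor_def; rewrite ler_pdivlMr // ltr_pdivrMr // -[s%:Z + 1]/((s + 1)%N%:Z).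
    rewrite -!pmulrn -!natrM ler_nat ltr_nat leq_divM addn1.
    by rewrite [(s.+1 * m)%N]mulnC mulnC ltn_ceil.
  have sm : (s * m <= t - r)%N by apply: leq_divM.
  (* From s m <= t - r <= k m; this makes the natural subtraction k - s agree with the rational
     one. *)
  have sk : (s <= k)%N by rewrite -(leq_pmul2r mn0); lia.
  rewrite floorE -pmulrn -natrB // ler_pdivrMr // -natrM ler_nat.
  by apply: min_anticode_dim_singleton => //; rewrite -/t; lia.
- move=> r r1 rt; rewrite /a /delsarte_gw.
  have [R -> rR] := min_anticode_dim_ge km rt.
  rewrite natrM [m%:R * _]mulrC mulfK ?gt_eqF // [R%:R]pmulrn ler_int ceil_le_int.
  by rewrite -pmulrn ler_pdivrMr // -natrM ler_nat mulnC.
Qed.
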